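(* Let $(\mathcal{E},\mathcal{L},\mathcal{B})$ be a normal labelled space, $R$ a unital commutative ring, $B$ an $R$-algebra and $\phi:L_R(\mathcal{E},\mathcal{L},\mathcal{B})\to B$ an $R$-algebra homomorphism. Then $\phi$ is injective if and only if its restriction to the abelian core $M(L_R(\mathcal{E},\mathcal{L},\mathcal{B}))$ is injective.
   Context: A graph $\mathcal{E}=(\mathcal{E}^0,\mathcal{E}^1,r,s)$ consists of a set of vertices $\mathcal{E}^0$, a set of edges $\mathcal{E}^1$ and maps $r,s:\mathcal{E}^1\to\mathcal{E}^0$. A finite path is a sequence $\lambda=\lambda_1\cdots\lambda_n$ of edges with $r(\lambda_i)=s(\lambda_{i+1})$, with $s(\lambda)=s(\lambda_1)$, $r(\lambda)=r(\lambda_n)$. A labelled graph $(\mathcal{E},\mathcal{L})$ is a graph with a surjective map $\mathcal{L}:\mathcal{E}^1\to\mathcal{A}$ onto a set $\mathcal{A}$ (the alphabet), extended to paths by $\mathcal{L}(\lambda)=\mathcal{L}(\lambda_1)\cdots\mathcal{L}(\lambda_n)$. $\mathcal{L}^*(\mathcal{E})$ denotes the set of words $\mathcal{L}(\lambda)$ for finite paths $\lambda$ of positive length, together with the empty word $\omega$; $|\alpha|$ is the length of a word and $\alpha_{1,k}$ its prefix of length $k$. For $A\subseteq\mathcal{E}^0$ and $\alpha\in\mathcal{L}^*(\mathcal{E})$, $r(A,\alpha)=\{r(\lambda)\mid \mathcal{L}(\lambda)=\alpha,\ s(\lambda)\in A\}$ if $\alpha\neq\omega$ and $r(A,\omega)=A$;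 $r(\alpha)=r(\mathcal{E}^0,\alpha)$; $\mathcal{L}(A\mathcal{E}^1)=\{a\in\mathcal{A}\mid r(A,a)\neq\emptyset\}$. A labelled space $(\mathcal{E},\mathcal{L},\mathcal{B})$ is a labelled graph with a family $\mathcal{B}$ of subsets of $\mathcal{E}^0$ closed under finite intersections and finite unions, containing $r(\alpha)$ for all non-empty $\alpha\in\mathcal{L}^*(\mathcal{E})$, and with $r(A,\alpha)\in\mathcal{B}$ for all $A\in\mathcal{B}$, $\alpha\in\mathcal{L}^*(\mathcal{E})$. It is normal if additionally $r(A\cap B,\alpha)=r(A,\alpha)\cap r(B,\alpha)$ for all $A,B\in\mathcal{B}$ and non-empty $\alpha$, and $\mathcal{B}$ is closed under relative complements. A non-empty $A\in\mathcal{B}$ is regular if $0<|\mathcal{L}(B\mathcal{E}^1)|<\infty$ for every non-empty $B\in\mathcal{B}$ with $B\subseteq A$; $\mathcal{B}_{reg}$ is the set of regular sets together with $\emptyset$. For $\alpha\in\mathcal{L}^*(\mathcal{E})$, $\mathcal{B}_\alpha=\{A\in\mathcal{B}\mid A\subseteq r(\alpha)\}$. The Leavitt labelled path algebra $L_R(\mathcal{E},\mathcal{L},\mathcal{B})$ is the universal $R$-algebra generated by $\{p_A\mid A\in\mathcal{B}\}\cup\{s_a,s_a^*\mid a\in\mathcal{A}\}$ subject to: (i) $p_{A\cap B}=p_Ap_B$, $p_{A\cup B}=p_A+p_B-p_{A\cap B}$, $p_\emptyset=0$; (ii) $p_As_a=s_ap_{r(A,a)}$ and $s_a^*p_A=p_{r(A,a)}s_a^*$;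 (iii) $s_a^*s_a=p_{r(a)}$ and $s_b^*s_a=0$ for $b\neq a$; (iv) $s_as_a^*s_a=s_a$, $s_a^*s_as_a^*=s_a^*$; (v) $p_A=\sum_{a\in\mathcal{L}(A\mathcal{E}^1)}s_ap_{r(A,a)}s_a^*$ for every $A\in\mathcal{B}_{reg}$. For $\alpha=a_1\cdots a_n$ put $s_\alpha=s_{a_1}\cdots s_{a_n}$, $s_\alpha^*=s_{a_n}^*\cdots s_{a_1}^*$, and $s_\omega$, $s_\omega^*$ are omitted in products. A pair $(\gamma,C)$ with $\gamma\in\mathcal{L}^*(\mathcal{E})$ non-empty and $C\in\mathcal{B}_\gamma$ is a cycle if $r(B,\gamma)=B$ for every $B\in\mathcal{B}_\gamma$ with $B\subseteq C$. A cycle has an exit if there exist $0\le k\le|\gamma|$ and non-empty $B\in\mathcal{B}$ with $B\subseteq r(C,\gamma_{1,k})$ and $\mathcal{L}(B\mathcal{E}^1)\neq\{\gamma_{k+1}\}$ (where $\gamma_{|\gamma|+1}=\gamma_1$). The abelian core $M(L_R(\mathcal{E},\mathcal{L},\mathcal{B}))$ is the $R$-subalgebra spanned by the elements $s_\alpha p_As_\alpha^*$, $s_\alpha p_Cs_\gamma^*s_\alpha^*$ and $s_\alpha s_\gamma p_Cs_\alpha^*$, where $\alpha\in\mathcal{L}^*(\mathcal{E})$, $A\in\mathcal{B}_\alpha$, and $(\gamma,C)$ is a cycle without exits. *)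

(* Defs.v *)
From Stdlib Require List.
From HB Require Import structures.
From mathcomp Require Import all_boot all_order all_algebra.
From mathcomp Require Import boolp classical_sets.
Set Implicit Arguments. Unset Strict Implicit. Unset Printing Implicit Defensive.
Import GRing.Theory.
Local Open Scope classical_set_scope.
Local Open Scope ring_scope.

(* No unit is required (Leavitt labelled path algebras are in general  *)
(* non-unital), and homomorphisms need not preserve any unit.          *)
Record nalg (R : comPzRingType) := NAlg {
  nacarrier :> lmodType R;
  namul : nacarrier -> nacarrier -> nacarrier;
  namulA : forall x y z, namul x (namul y z) = namul (namul x y) z;
  namulDl : forall x y z, namul (x + y) z = namul x z + namul y z;
  namulDr : forall x y z, namul x (y + z) = namul x y + namul x z;
  namulZl : forall (c : R) x y, namul (c *: x) y = c *: namul x y;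
  namulZr : forall (c : R) x y, namul x (c *: y) = c *: namul x y
}.
Arguments namul {R} n _ _.

Definition nalg_hom (R : comPzRingType) (A B : nalg R) (f : A -> B) : Prop :=
  [/\ forall x y : A, f (x + y) = f x + f y,
      forall (c : R) (x : A), f (c *: x) = c *: f x
    & forall x y : A, f (namul A x y) = namul B (f x) (f y)].

Section LabelledGraph.
Variables (E0 E1 Alph : Type) (r s : E1 -> E0) (lab : E1 -> Alph).

Fixpoint cpath (e : E1) (p : seq E1) : Prop :=
  match p with
  | [::] => True
  | f :: q => r e = s f /\ cpath f q
  end.

Definition Lstar : set (seq Alph) :=
  [set w | w = [::] \/ exists e p, cpath e p /\ map lab (e :: p) = w].

Definition rg (A : set E0) (w : seq Alph) : set E0 :=
  match w with
  | [::] => A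
  | _ :: _ => [set v | exists e p, [/\ cpath e p, A (s e),
                         map lab (e :: p) = w & v = r (last e p)]]
  end.

Definition rw (w : seq Alph) : set E0 := rg setT w.

Definition LE1 (A : set E0) : set Alph := [set a | rg A [:: a] !=set0].

Definition finite_set_l (T : Type) (X : set T) : Prop :=
  exists l : seq T, forall x, X x -> List.In x l.

Variable BB : set (set E0).

Definition labelled_space : Prop :=
  (forall a : Alph, exists e, lab e = a) /\
  BB set0 /\
  (forall A B, BB A -> BB B -> BB (A `&` B)) /\
  (forall A B, BB A -> BB B -> BB (A `|` B)) /\
  (forall w, Lstar w -> w <> [::] -> BB (rw w)) /\
  (forall A w, BB A -> Lstar w -> BB (rg A w)).

Definition normal_labelled_space : Prop :=
  [/\ labelled_space,
      (forall A B w, BB A -> BB B -> Lstar w -> w <> [::] ->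
          rg (A `&` B) w = rg A w `&` rg B w)
    & (forall A B, BB A -> BB B -> BB (A `\` B))].

Definition regular (A : set E0) : Prop :=
  [/\ BB A, A !=set0 &
      forall B, BB B -> B !=set0 -> B `<=` A ->
        LE1 B !=set0 /\ finite_set_l (LE1 B)].

Definition Breg (A : set E0) : Prop := regular A \/ A = set0.

Definition Bal (w : seq Alph) (A : set E0) : Prop := BB A /\ A `<=` rw w.

Definition is_cycle (g : seq Alph) (C : set E0) : Prop :=
  [/\ Lstar g, g <> [::], Bal g C &
      forall B, Bal g B -> B `<=` C -> rg B g = B].

(* gamma_{k+1}, with gamma_{|gamma|+1} = gamma_1 (0-indexed: k mod |gamma|) *)
Definition has_exit (g : seq Alph) (C : set E0) : Prop :=
  exists k, (k <= size g)%N /\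
    exists B, [/\ BB B, B !=set0, B `<=` rg C (take k g) &
       LE1 B <> [set a | onth g (k %% size g) = Some a]].

Definition cycle_without_exits (g : seq Alph) (C : set E0) : Prop :=
  is_cycle g C /\ ~ has_exit g C.

Definition LLPA_family (R : comPzRingType) (C : nalg R)
    (q : set E0 -> C) (t t' : Alph -> C) : Prop :=
      (forall A B, BB A -> BB B -> q (A `&` B) = namul C (q A) (q B)) /\
      (forall A B, BB A -> BB B -> q (A `|` B) = q A + q B - q (A `&` B)) /\
      q set0 = 0 /\
      (forall A a, BB A -> namul C (q A) (t a) = namul C (t a) (q (rg A [:: a]))) /\
      (forall A a, BB A -> namul C (t' a) (q A) = namul C (q (rg A [:: a])) (t' a)) /\
      (forall a, namul C (t' a) (t a) = q (rw [:: a])) /\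
      (forall a b, a <> b -> namul C (t' b) (t a) = 0) /\
      (forall a, namul C (namul C (t a) (t' a)) (t a) = t a) /\
      (forall a, namul C (namul C (t' a) (t a)) (t' a) = t' a) /\
      (forall A (l : seq Alph), Breg A -> List.NoDup l ->
         (forall a, List.In a l <-> LE1 A a) ->
         q A = \sum_(a <- l) namul C (namul C (t a) (q (rg A [:: a]))) (t' a)).

(* (L, p, s, s^* ) is the universal R-algebra generated by p_A (A in B),
   s_a, s_a^* subject to (i)-(v), i.e. the Leavitt labelled path algebra
   L_R(E, L, B) (characterised up to unique isomorphism). *)
Definition is_LLPA (R : comPzRingType) (L : nalg R)
    (p : set E0 -> L) (sg sg' : Alph -> L) : Prop :=
  LLPA_family p sg sg' /\
  forall (C : nalg R) (q : set E0 -> C) (t t' : Alph -> C),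
    LLPA_family q t t' ->
    (exists psi : L -> C, [/\ nalg_hom psi,
        (forall A, BB A -> psi (p A) = q A),
        (forall a, psi (sg a) = t a) & (forall a, psi (sg' a) = t' a)]) /\
    (forall psi1 psi2 : L -> C, nalg_hom psi1 -> nalg_hom psi2 ->
        (forall A, BB A -> psi1 (p A) = q A) ->
        (forall a, psi1 (sg a) = t a) -> (forall a, psi1 (sg' a) = t' a) ->
        (forall A, BB A -> psi2 (p A) = q A) ->
        (forall a, psi2 (sg a) = t a) -> (forall a, psi2 (sg' a) = t' a) ->
        psi1 = psi2).

Section Core.
Variables (R : comPzRingType) (L : nalg R) (p : set E0 -> L) (sg sg' : Alph -> L).

(* s_alpha x  and  x s_alpha^*  (s_omega omitted) *)
Definition lmulw (w : seq Alph) (x : L) : L := foldr (fun a y => namul L (sg a) y) x w.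
Definition rmulw (x : L) (w : seq Alph) : L := foldr (fun a y => namul L y (sg' a)) x w.

Definition core_gen : set L :=
  [set x | exists al, Lstar al /\
     ((exists A, Bal al A /\ x = lmulw al (rmulw (p A) al)) \/
      exists g C, cycle_without_exits g C /\
        (x = lmulw al (rmulw (rmulw (p C) g) al) \/
         x = lmulw al (rmulw (lmulw g (p C)) al)))].

Definition abelian_core : set L :=
  [set x | exists l : seq (R * L), (forall c, List.In c l -> core_gen c.2) /\
           x = \sum_(c <- l) c.1 *: c.2].
End Core.

End LabelledGraph.

(* Main.v *)
(** Every nonzero x in the kernel of phi can be compressed, by multiplying on
    both sides, to a nonzero element of the abelian core.  Write x as a
    combination of the s_alpha p_A s_beta^*.  Induction on the length of the
    beta gives y with x y = sum_alpha c_alpha s_alpha p_E, with distinct alpha,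
    nonzero coefficients and nonempty E contained in every r(alpha); the
    Cuntz-Krieger relation (v) enters only when no letter shortens x and E is
    regular.  Multiplying by some s_mu^* leaves
    c p_E + sum_delta c_delta s_delta p_E with c <> 0 and nonempty delta.
    A term s_delta p_E for which (delta, E) is not a cycle without exits can be
    removed by compressing along a path to a smaller set, so that finally only
    such cycles remain and the element lies in the core.  It is nonzero because
    c p_E is: L acts on functions on X x Z, where X consists of the
    boundary paths (sequences of letters with compatible prime filters of BB)
    and Z records the degree. *)

Require Import Defs.
From HB Require Import structures.
From mathcomp Require Import all_boot all_order all_algebra.
From mathcomp Require Import boolp classical_sets functions filter.
Set Implicit Arguments. Unset Strict Implicit. Unset Printing Implicit Defensive.
Import GRing.Theory.
Local Open Scope classical_set_scope.
Local Open Scope ring_scope.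

Arguments rg : simpl never.

(** * Lists: membership, distinctness and filtering *)

Lemma List_InP (T : eqType) (a : T) l : List.In a l <-> a \in l.
Proof.
elim: l => [//|b l IH]; rewrite inE /=; split=> [[->|/IH->]|/orP[/eqP->|/IH]].
- by rewrite eqxx.
- by rewrite orbT.
- by left.
- by right.
Qed.

Lemma List_NoDupP (T : eqType) (l : seq T) : List.NoDup l <-> uniq l.
Proof.
elim: l => [|a l IH]; first by split=> // _; constructor.
split=> [H|/= /andP[al /IH ul]]; last first.
  by constructor=> // /List_InP; exact/negP.
inversion H as [|? ? al ul]; subst; rewrite /= (IH.1 ul) andbT.
by apply/negP => /List_InP.
Qed.

Lemma size_filter_lt (T : eqType) (P : pred T) (l : seq T) x :
  x \in l -> ~~ P x -> (size [seq y <- l | P y] < size l)%N.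
Proof.
move=> xl Px; rewrite size_filter -(count_predC P l) -addn1 leq_add2l -has_count.
by apply/hasP; exists x.
Qed.

(** * Relative ranges *)

Section LabelledSpace.
Variables (E0 E1 Alph : Type) (r s : E1 -> E0) (lab : E1 -> Alph).
Local Notation rg := (rg r s lab).
Local Notation rw := (rw r s lab).
Local Notation Lstar := (Lstar r s lab).
Local Notation LE1 := (LE1 r s lab).

Lemma rg_letter (A : set E0) a v :
  rg A [:: a] v <-> exists e, [/\ A (s e), lab e = a & v = r e].
Proof.
split=> [[e [[|f q]]]|[e [Ae <- ->]]]; last by exists e, [::].
  by move=> [_ Ae [<-] ->]; exists e.
by move=> [].
Qed.

Lemma rg_cons (A : set E0) a w : rg A (a :: w) = rg (rg A [:: a]) w.
Proof.
case: w => [//|b w]; apply/seteqP; split=> v /=.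
  move=> [e [q []]]; case: q => [//|f q].
  move=> /= [ef cq] Ae [ea fb qw] ->.
  exists f, q; split=> //=; last by rewrite fb qw.
  by rewrite -ef; apply/rg_letter; exists e.
move=> [f [q [cq /rg_letter[e [Ae ea sf]] qw ->]]].
by exists e, (f :: q); split=> //; rewrite -ea -qw.
Qed.

Lemma rg_cat (A : set E0) u w : rg A (u ++ w) = rg (rg A u) w.
Proof.
by elim: u A => [//|a u IH] A; rewrite cat_cons rg_cons IH [in RHS]rg_cons.
Qed.

Lemma rg_rcons (A : set E0) w a : rg A (rcons w a) = rg (rg A w) [:: a].
Proof. by rewrite -cats1 rg_cat. Qed.

Lemma rg_mono (A B : set E0) w : A `<=` B -> rg A w `<=` rg B w.
Proof.
by case: w => [//|a w] AB v [e [q [cq Ae qw ->]]]; exists e, q; split=> //; exact: AB.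
Qed.

Lemma rg_set0 w : rg set0 w = set0.
Proof. by case: w => [//|a w]; apply/seteqP; split=> // v [e [q []]]. Qed.

Lemma rg_setU (A B : set E0) w : rg (A `|` B) w = rg A w `|` rg B w.
Proof.
case: w => [//|a w]; apply/seteqP; split=> v.
  by move=> [e [q [cq [?|?] qw ->]]]; [left|right]; exists e, q.
by move=> [|]; apply: rg_mono => x; [left|right].
Qed.

Lemma rg_sub_rw (A : set E0) w : rg A w `<=` rw w.
Proof. exact: rg_mono. Qed.

Lemma rg_rw u w : rg (rw u) w = rw (u ++ w).
Proof. by rewrite /Defs.rw rg_cat. Qed.

Lemma rw_catr u w : rw (u ++ w) `<=` rw w.
Proof. by rewrite -rg_rw; exact: rg_sub_rw. Qed.

(** A vertex in the range supplies a path labelled [w]. This extends the closure and intersection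
    laws to all words, without membership in [Lstar]. *)
Lemma rg_not_Lstar (A : set E0) w : ~ Lstar w -> rg A w = set0.
Proof.
case: w => [[]|a w nL]; first by left.
apply/seteqP; split=> // v [e [q [cq _ qw _]]].
by apply: nL; right; exists e, q.
Qed.

Lemma LE1_mono (A B : set E0) : A `<=` B -> LE1 A `<=` LE1 B.
Proof. by move=> AB a [v rv]; exists v; exact: rg_mono rv. Qed.

Variable BB : set (set E0).
Hypothesis HN : normal_labelled_space r s lab BB.

Lemma BB0 : BB set0.
Proof. by case: HN => -[_ []]. Qed.

Lemma BBI A B : BB A -> BB B -> BB (A `&` B).
Proof. by case: HN => -[_ [_ []]] H _ _ _; exact: H. Qed.

Lemma BBU A B : BB A -> BB B -> BB (A `|` B).
Proof. by case: HN => -[_ [_ [_ []]]] H _ _ _; exact: H. Qed.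

Lemma BBD A B : BB A -> BB B -> BB (A `\` B).
Proof. by case: HN => _ _; exact. Qed.

Lemma BB_rg A w : BB A -> BB (rg A w).
Proof.
move=> BA; have [Lw|/rg_not_Lstar->] := pselect (Lstar w); last exact: BB0.
by case: HN => -[_ [_ [_ [_ [_]]]]] H _ _; exact: H.
Qed.

Lemma BB_rw a w : BB (rw (a :: w)).
Proof.
have [Lw|/rg_not_Lstar] := pselect (Lstar (a :: w)).
  by case: HN => -[_ [_ [_ [_ []]]]] H _ _ _; exact: H.
by rewrite /Defs.rw => ->; exact: BB0.
Qed.

Lemma rg_setI A B w : BB A -> BB B -> rg (A `&` B) w = rg A w `&` rg B w.
Proof.
move=> BA BbB; have [Lw|nL] := pselect (Lstar w); last first.
  by rewrite !rg_not_Lstar // setI0.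
by case: w Lw => [//|a w] Lw; case: HN => _ H _; exact: H.
Qed.

(** By normality the ranges of [A] minus [B] and of [B] meet in the range of the empty set;
    additivity over unions gives the rest. *)
Lemma rg_setD A B w : BB A -> BB B -> rg (A `\` B) w = rg A w `\` rg B w.
Proof.
move=> BA BbB; apply/seteqP; split=> v; last first.
  move=> [Av nBv]; have AD : A `<=` (A `\` B) `|` B.
    by move=> x Ax; have [Bx|nBx] := pselect (B x); [right|left].
  by have := rg_mono AD Av; rewrite rg_setU => -[|/nBv].
move=> Dv; split; first by apply: rg_mono Dv => x [].
move=> Bv; have : rg ((A `\` B) `&` B) w v by rewrite rg_setI //; exact: BBD.
suff -> : (A `\` B) `&` B = set0 by rewrite rg_set0.
by apply/seteqP; split=> // x [[]].
Qed.

End LabelledSpace.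

(** * Endomorphism algebras and subalgebras *)

Section EndAlgebra.
Variables (R : comPzRingType) (U : lmodType R).

Definition lin_pred : {pred U -> U} := fun f => `[< linear f >].

Lemma lin_predP (f : U -> U) : f \in lin_pred <-> linear f.
Proof. by split=> [/asboolP|?] //; exact/asboolP. Qed.

Lemma lin_pred_submod : submod_closed lin_pred.
Proof.
split=> [|c f g /lin_predP lf /lin_predP lg]; apply/lin_predP => a u v.
  by rewrite /GRing.zero /= scaler0 addr0.
change (c *: f (a *: u + v) + g (a *: u + v) =
        a *: (c *: f u + g u) + (c *: f v + g v)).
by rewrite lf lg !scalerDr !scalerA [c * a]mulrC addrACA.
Qed.

HB.instance Definition _ :=
  GRing.isSubmodClosed.Build R (U -> U) lin_pred lin_pred_submod.

Record endo := Endo { endo_fun :> U -> U; _ : endo_fun \in lin_pred }.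

HB.instance Definition _ := [isSub for endo_fun].
HB.instance Definition _ := [Choice of endo by <:].
HB.instance Definition _ := [SubChoice_isSubLmodule of endo by <:].

Lemma endo_linear (f : endo) : linear f.
Proof. by case: f => f lf; exact/lin_predP. Qed.

Lemma endo_additive (f : endo) u v : f (u + v) = f u + f v.
Proof. by have := endo_linear f 1 u v; rewrite !scale1r. Qed.

Lemma endo_scalable (f : endo) c u : f (c *: u) = c *: f u.
Proof.
have f0 : f 0 = 0 by apply: (@addrI _ (f 0)); rewrite -endo_additive !addr0.
by have := endo_linear f c u 0; rewrite f0 !addr0.
Qed.

Lemma endoP (f g : endo) : f =1 g <-> f = g.
Proof. by split=> [fg|->//]; apply: val_inj; apply/funext. Qed.

Lemma endo_comp_subproof (f g : endo) : f \o g \in lin_pred.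
Proof. by apply/lin_predP => a u v /=; rewrite !endo_linear. Qed.

Definition endo_comp (f g : endo) := Endo (endo_comp_subproof f g).

Lemma endoD (f g : endo) u : (f + g) u = f u + g u. Proof. by []. Qed.
Lemma endo0 u : (0 : endo) u = 0. Proof. by []. Qed.
Lemma endo_sum I (l : seq I) (F : I -> endo) u :
  (\sum_(i <- l) F i) u = \sum_(i <- l) F i u.
Proof.
by elim: l => [|i l IH]; rewrite ?big_nil ?endo0 // !big_cons endoD IH.
Qed.

Definition endo_nalg : nalg R.
Proof.
refine (@NAlg R endo endo_comp _ _ _ _ _).
- by move=> f g h; apply/endoP.
- by move=> f g h; apply/endoP.
- by move=> f g h; apply/endoP => u; exact: endo_additive.
- by move=> c f g; apply/endoP.
- by move=> c f g; apply/endoP => u; exact: endo_scalable.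
Defined.

End EndAlgebra.

(** * Bilinearity of the product, and subalgebras cut out by a closed predicate *)

Section NalgTheory.
Variables (R : comPzRingType) (A : nalg R).
Local Notation "x ** y" := (namul A x y) (at level 40, left associativity).

Lemma namul0l x : 0 ** x = 0.
Proof. by apply: (@addrI _ (0 ** x)); rewrite -namulDl !addr0. Qed.

Lemma namul0r x : x ** 0 = 0.
Proof. by apply: (@addrI _ (x ** 0)); rewrite -namulDr !addr0. Qed.

Lemma namulNl x y : (- x) ** y = - (x ** y).
Proof. by rewrite -scaleN1r namulZl scaleN1r. Qed.

Lemma namul_suml I (l : seq I) (P : pred I) (F : I -> A) x :
  (\sum_(i <- l | P i) F i) ** x = \sum_(i <- l | P i) F i ** x.
Proof. by apply: (big_morph (fun y => y ** x)) => [y z|]; rewrite ?namulDl ?namul0l. Qed.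

Lemma namul_sumr I (l : seq I) (P : pred I) (F : I -> A) x :
  x ** (\sum_(i <- l | P i) F i) = \sum_(i <- l | P i) x ** F i.
Proof. by apply: (big_morph (fun y => x ** y)) => [y z|]; rewrite ?namulDr ?namul0r. Qed.

Variable P : A -> Prop.
Hypotheses (P0 : P 0) (PD : forall x y, P x -> P y -> P (x + y))
  (PZ : forall c x, P x -> P (c *: x)) (PM : forall x y, P x -> P y -> P (x ** y)).

Definition subalg_pred : {pred A} := fun x => `[< P x >].

Lemma subalg_pred_submod : submod_closed subalg_pred.
Proof.
split=> [|c x y /asboolP Px /asboolP Py]; apply/asboolP => //.
by apply: PD => //; exact: PZ.
Qed.

HB.instance Definition _ :=
  GRing.isSubmodClosed.Build R A subalg_pred subalg_pred_submod.

Record subalg := Subalg { subalg_val :> A; _ : subalg_val \in subalg_pred }.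

HB.instance Definition _ := [isSub for subalg_val].
HB.instance Definition _ := [Choice of subalg by <:].
HB.instance Definition _ := [SubChoice_isSubLmodule of subalg by <:].

Lemma subalg_mul_subproof (x y : subalg) : subalg_val x ** subalg_val y \in subalg_pred.
Proof.
by case: x y => x Px [y Py]; apply/asboolP; apply: PM; exact/asboolP.
Qed.

Definition subalg_mul x y := Subalg (subalg_mul_subproof x y).

Definition subalg_nalg : nalg R.
Proof.
refine (@NAlg R subalg subalg_mul _ _ _ _ _).
- by move=> x y z; apply: val_inj; exact: namulA.
- by move=> x y z; apply: val_inj; exact: namulDl.
- by move=> x y z; apply: val_inj; exact: namulDr.
- by move=> c x y; apply: val_inj; exact: namulZl.
- by move=> c x y; apply: val_inj; exact: namulZr.
Defined.

Lemma subalg_val_sum I (l : seq I) (F : I -> subalg_nalg) :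
  subalg_val (\sum_(i <- l) F i) = \sum_(i <- l) subalg_val (F i).
Proof. by elim: l => [|i l IH]; rewrite ?big_nil // !big_cons -IH. Qed.

End NalgTheory.

(** * The boundary path representation *)

Section Representation.
Variables (E0 E1 : Type) (Alph : eqType) (r s : E1 -> E0) (lab : E1 -> Alph).
Local Notation rg := (rg r s lab).
Local Notation rw := (rw r s lab).
Local Notation LE1 := (LE1 r s lab).
Variable BB : set (set E0).
Hypothesis HN : normal_labelled_space r s lab BB.
Local Notation regular := (regular r s lab BB).

(* The empty family is allowed: it arises as [pull a F]. *)
Definition prime_filter (F : set (set E0)) : Prop :=
  [/\ F `<=` BB, ~ F set0,
      forall A B, BB A -> BB B -> (F (A `&` B) <-> F A /\ F B)
    & forall A B, BB A -> BB B -> (F (A `|` B) <-> F A \/ F B)].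

Definition pull (a : Alph) (F : set (set E0)) : set (set E0) :=
  [set A | BB A /\ F (rg A [:: a])].

(** Taking ranges along [a] preserves the empty set, unions and, by normality, intersections of
    members of [BB]. *)
Lemma prime_filter_pull a F : prime_filter F -> prime_filter (pull a F).
Proof.
move=> [FB F0 FI FU]; split=> [A [//]|[_]|A B BA BbB|A B BA BbB].
- by rewrite rg_set0.
- rewrite /pull /= (rg_setI HN) // FI; try exact: (BB_rg HN).
  by split=> [[_ []]|[[_ ?] [_ ?]]] //; split=> //; exact: (BBI HN).
- rewrite /pull /= rg_setU FU; try exact: (BB_rg HN).
  split=> [[_ [?|?]]|[[_ ?]|[_ ?]]]; [by left|by right| |];
    by split; [exact: (BBU HN)|by [left|right]].
Qed.

Lemma prime_filter_at v : prime_filter [set A | BB A /\ A v].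
Proof.
split=> [A [] //|[]//|A B BA BbB|A B BA BbB] /=.
  by split=> [[_ []]|[[_ ?] [_ ?]]] //; split=> //; exact: (BBI HN).
split=> [[_ [?|?]]|[[_ ?]|[_ ?]]]; [by left|by right| |];
  by split; [exact: (BBU HN)|by [left|right]].
Qed.

(* Otherwise finitely many members of F would meet in a nonempty subset of A
   emitting no letter. *)
Lemma regular_letter F A : prime_filter F -> regular A -> F A ->
  exists a, forall B, F B -> rg B [:: a] !=set0.
Proof.
move=> [FB F0 FI _] [BA [v Av] Areg] FA; apply: contrapT => nex.
have [_ [l Al]] := Areg A BA (ex_intro _ v Av) (@subset_refl _ A).
have [B FBB Bl] : exists2 B, F B & forall a, List.In a l -> rg B [:: a] = set0.
  elim: l {Al} => [|a l [B FBB Bl]]; first by exists A.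
  have [C FC Ca] : exists2 C, F C & rg C [:: a] = set0.
    apply: contrapT => nC; apply: nex; exists a => C FC.
    by apply/set0P/eqP => Ca; apply: nC; exists C.
  exists (B `&` C); first by apply/FI => //; exact: FB.
  move=> b /= [<-|/Bl Bb]; apply/seteqP; split=> // x.
    by rewrite -Ca; apply: rg_mono => y [].
  by rewrite -Bb; apply: rg_mono => y [].
have FAB : F (A `&` B) by apply/FI => //; exact: FB.
have AB0 : (A `&` B) !=set0 by apply/set0P/eqP => AB0; apply: F0; rewrite -AB0.
have sA : A `&` B `<=` A by move=> x [].
have [[a [x ax]] _] := Areg _ (FB _ FAB) AB0 sA.
have : rg B [:: a] x by apply: rg_mono ax => y [].
by rewrite Bl //; apply: Al; exists x; exact: rg_mono ax.
Qed.

(** If [F] has a regular member, take [a] from [regular_letter]: the sets [rg B [:: a]] with [B] in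
    [F] form a filter base, and an ultrafilter on vertices refining it, cut down to [BB], serves as
    [G]. *)
Lemma prime_filter_next F : prime_filter F ->
  (forall A, regular A -> ~ F A) \/
  exists a G, [/\ prime_filter G, G (rw [:: a]) & F = pull a G].
Proof.
move=> pF; have [FB F0 FI FU] := pF.
have [[A [regA FA]]|nA] := pselect (exists A, regular A /\ F A); last first.
  by left=> A regA FA; apply: nA; exists A.
right; have [a aF] := regular_letter pF regA FA; exists a.
have : ProperFilter (filter_from F (fun B => rg B [:: a])).
  apply: filter_from_proper => //; apply: filter_from_filter; first by exists A.
  move=> B C FBB FC; exists (B `&` C); first by apply/FI => //; exact: FB.
  by rewrite (rg_setI HN) //; exact: FB.
move=> /ultraFilterLemma[G [GU FG]].
have GF B : F B -> G (rg B [:: a]) by move=> FBB; apply: FG; exists B.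
have nG0 : ~ G set0 by exact: filter_not_empty.
exists [set B | BB B /\ G B]; split.
- split=> [B []//|[]//|B C BbB BC|B C BbB BC] /=.
    split=> [[_ GBC]|[[_ GB] [_ GC]]].
      by split; split=> //; apply: filterS GBC => x [].
    by split; [exact: (BBI HN)|exact: filterI].
  split=> [[_ GBC]|[] [_ H]].
  + have [GB|GnB] := in_ultra_setVsetC B GU; first by left.
    by right; split=> //; apply: filterS (filterI GBC GnB) => x [[]].
  + by split; [exact: (BBU HN)|apply: filterS H => x; left].
  + by split; [exact: (BBU HN)|apply: filterS H => x; right].
- split; first exact: (BB_rw HN).
  by apply: filterS (GF _ FA); exact: rg_sub_rw.
apply/seteqP; split=> B.
  move=> FBB; have BbB := FB _ FBB; split=> //; split; last exact: GF.
  exact: (BB_rg HN).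
(* If [B] were not in [F], primeness would put [A] minus [B] in [F], and [G] would contain the
   disjoint ranges of that difference and of [B]. *)
move=> [BbB [_ GB]]; apply: contrapT => nFB; have BA := FB _ FA.
have AE : (A `\` B) `|` (A `&` B) = A.
  apply/seteqP; split=> x; first by move=> [[]|[]].
  by move=> Ax; have [Bx|nBx] := pselect (B x); [right|left].
have [|||FAB|] := (FU (A `\` B) (A `&` B) _ _).1; rewrite ?AE //.
- exact: (BBD HN).
- exact: (BBI HN).
- have : G (rg (A `\` B) [:: a] `&` rg B [:: a]) by apply: filterI => //; exact: GF.
  by rewrite (rg_setD HN) // => /filter_ex[x [[]]].
- by move=> /FI [].
Qed.

(* The word of labels of a path, a [None] marking its end, together with the
   filters on the ranges of its initial segments; what follows the first [None]
   carries no information. *)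
Definition point : Type := (nat -> option Alph) * (nat -> set (set E0)).

(** The [None] clause lets a path stop only where its filter has no regular member; this makes
    relation (v) hold in the representation. *)
Definition boundary (x : point) : Prop := forall n,
  prime_filter (x.2 n) /\
  match x.1 n with
  | Some a => x.2 n.+1 (rw [:: a]) /\ x.2 n = pull a (x.2 n.+1)
  | None => forall A, regular A -> ~ x.2 n A
  end.

Definition pshift (x : point) : point :=
  (fun n => x.1 n.+1, fun n => x.2 n.+1).

Definition pcons (a : Alph) (x : point) : point :=
  (fun n => if n is m.+1 then x.1 m else Some a,
   fun n => if n is m.+1 then x.2 m else pull a (x.2 0%N)).

Lemma boundary_shift x : boundary x -> boundary (pshift x).
Proof. by move=> bx n; exact: bx n.+1. Qed.

Lemma boundary_cons a x : boundary x -> x.2 0%N (rw [:: a]) -> boundary (pcons a x).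
Proof.
move=> bx xa [|n]; last exact: bx.
by split=> //=; apply: prime_filter_pull; case: (bx 0%N).
Qed.

Lemma pconsK a x : pshift (pcons a x) = x.
Proof. by case: x. Qed.

Lemma pshiftK a x : boundary x -> x.1 0%N = Some a -> pcons a (pshift x) = x.
Proof.
case: x => w F bx /= wa; have := bx 0%N; rewrite /= wa => -[_ [_ Fa]].
by congr (_, _); apply/funext => -[|n] //=.
Qed.

Lemma boundary_ex A : BB A -> A !=set0 -> exists2 x, boundary x & x.2 0%N A.
Proof.
move=> BA [v Av].
pose next F (y : option Alph * set (set E0)) := prime_filter F ->
  prime_filter y.2 /\
  match y.1 with
  | Some a => y.2 (rw [:: a]) /\ F = pull a y.2
  | None => forall A, regular A -> ~ F A
  end.
(* Primeness of [F] is a premise inside [next], so that a total choice function exists; its values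
   at other families are irrelevant. *)
have /choice[g gP] : forall F, exists y, next F y.
  move=> F; have [pF|npF] := pselect (prime_filter F); last first.
    by exists (None, F).
  have [nreg|[a [G [pG Ga FG]]]] := prime_filter_next pF.
    by exists (None, F).
  by exists (Some a, G).
pose F n := iter n (fun F => (g F).2) [set B | BB B /\ B v].
have pF n : prime_filter (F n).
  by elim: n => [|n IH]; [exact: prime_filter_at|case: (gP _ IH)].
exists (fun n => (g (F n)).1, F) => // n /=; split=> //.
by case: (gP _ (pF n)).
Qed.

(** * Operators on functions of boundary paths and degrees *)

Variable R : comPzRingType.

Definition rep_space : lmodType R := point * int -> R^o.

(* All generators act by operators of this shape, which reduces the relations
   to statements about boundary paths. *)
Definition subst_fun (P : set (point * int)) (h : point * int -> point * int)
  (f : rep_space) : rep_space := fun z => if `[< P z >] then f (h z) else 0.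

Lemma subst_fun_lin P h : subst_fun P h \in @lin_pred R rep_space.
Proof.
apply/lin_predP => c f g; apply/funext => z.
change (subst_fun P h (c *: f + g) z =
        c * subst_fun P h f z + subst_fun P h g z).
by rewrite /subst_fun; case: ifP => // _; rewrite mulr0 addr0.
Qed.

Definition subst_op P h : endo_nalg rep_space := Endo (subst_fun_lin P h).

(** The operators act by precomposition, so the underlying maps compose in the opposite order. *)
Lemma subst_op_comp P h Q k :
  namul _ (subst_op P h) (subst_op Q k) =
  subst_op [set z | P z /\ Q (h z)] (k \o h).
Proof.
apply: (proj1 (@endoP R rep_space _ _)) => f; apply/funext => z.
rewrite /= /subst_fun /= asbool_and.
by case: asboolP => // _; case: asboolP.
Qed.

Lemma subst_op_eq (P Q : set (point * int)) h k : (forall z, P z <-> Q z) ->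
  (forall z, P z -> h z = k z) -> subst_op P h = subst_op Q k.
Proof.
move=> PQ hk; apply: (proj1 (@endoP R rep_space _ _)) => f; apply/funext => z.
rewrite /= /subst_fun; case: asboolP => [Pz|nPz].
  by rewrite asboolT ?hk //; exact/PQ.
by rewrite asboolF // => /PQ.
Qed.

Lemma subst_op_False (P : set (point * int)) h :
  (forall z, ~ P z) -> subst_op P h = 0.
Proof.
move=> nP; apply: (proj1 (@endoP R rep_space _ _)) => f; apply/funext => z.
by rewrite /= /subst_fun asboolF.
Qed.

Definition rep_p (A : set E0) : endo_nalg rep_space :=
  subst_op [set z | boundary z.1 /\ z.1.2 0%N A] id.
(** Pulls back along removal of a leading [a]; the shift of the integer raises by one the degree in
    which a function is supported. *)
Definition rep_s (a : Alph) : endo_nalg rep_space :=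
  subst_op [set z | boundary z.1 /\ z.1.1 0%N = Some a]
           (fun z => (pshift z.1, z.2 - 1)).
Definition rep_s' (a : Alph) : endo_nalg rep_space :=
  subst_op [set z | boundary z.1 /\ z.1.2 0%N (rw [:: a])]
           (fun z => (pcons a z.1, z.2 + 1)).

Lemma boundary_head x a A : boundary x -> x.1 0%N = Some a -> BB A ->
  (x.2 0%N A <-> x.2 1%N (rg A [:: a])).
Proof.
by move=> bx xa BA; have := bx 0%N; rewrite xa => -[_ [_ ->]]; split=> [[]|].
Qed.

Lemma boundary_rw x a : boundary x -> x.1 0%N = Some a -> x.2 1%N (rw [:: a]).
Proof. by move=> bx xa; have := bx 0%N; rewrite xa => -[_ []]. Qed.

(** Removing and restoring a leading [a] is the identity on paths starting with [a], so each summand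
    of relation (v) becomes a projection onto some of these paths. *)
Lemma rep_sps' A a : BB A ->
  namul _ (namul _ (rep_s a) (rep_p (rg A [:: a]))) (rep_s' a) =
  subst_op [set z | [/\ boundary z.1, z.1.1 0%N = Some a & z.1.2 0%N A]] id.
Proof.
move=> BA; rewrite !subst_op_comp; apply: subst_op_eq => -[x n] /=.
  split=> [[[[bx xa] [_ xA]] _]|[bx xa xA]].
    by split=> //; apply/(boundary_head bx xa BA).
  split; last by split; [exact: boundary_shift|exact: boundary_rw].
  split=> //; split; first exact: boundary_shift.
  exact/(boundary_head bx xa BA).
by move=> [[[bx xa] _] _]; rewrite pshiftK // subrK.
Qed.

Lemma rep_family : LLPA_family r s lab BB rep_p rep_s rep_s'.
Proof.
split; [|split; [|split; [|split; [|split; [|split; [|split; [|split; [|split]]]]]]]].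
- move=> A B BA BbB; rewrite subst_op_comp; apply: subst_op_eq => -[x n] //=.
  split=> [[bx]|[[bx xA] [_ xB]]]; last first.
    by split=> //; have [_ _ FI _] := (bx 0%N).1; exact/FI.
  by have [_ _ FI _] := (bx 0%N).1; move/FI => [].
- move=> A B BA BbB; apply: (proj1 (@endoP R rep_space _ _)) => f.
  apply/funext => -[x n].
  change (rep_p (A `|` B) f (x, n) =
    rep_p A f (x, n) + rep_p B f (x, n) - rep_p (A `&` B) f (x, n)).
  rewrite /= /subst_fun /=; have [bx|nbx] := pselect (boundary x); last first.
    by rewrite !asboolF ?subr0 ?addr0 // => -[].
  have [_ _ FI FU] := (bx 0%N).1.
  rewrite !asbool_and (asboolT bx) /=.
  rewrite (asbool_equiv_eq (FI A B BA BbB)) (asbool_equiv_eq (FU A B BA BbB)).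
  rewrite asbool_or asbool_and.
  by case: asboolP => _; case: asboolP => _ /=; rewrite ?addrK ?subr0 ?addr0 ?add0r.
- by apply: subst_op_False => -[x n] /= [bx]; have [_ + _ _] := (bx 0%N).1.
- move=> A a BA; rewrite !subst_op_comp; apply: subst_op_eq => -[x n] //=.
  split=> [[[bx xA] [_ xa]]|[[bx xa] [_ xA]]].
    do 2?split=> //; first exact: boundary_shift.
    exact/(boundary_head bx xa BA).
  by do 2?split=> //; exact/(boundary_head bx xa BA).
- move=> A a BA; rewrite !subst_op_comp; apply: subst_op_eq => -[x n] //=.
  split=> [[[bx xa] [_ [_ xA]]]|[[bx xA] [_ xa]]]; first by [].
  by do 2?split=> //; exact: boundary_cons.
- move=> a; rewrite !subst_op_comp; apply: subst_op_eq => -[x n] /=.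
    by split=> [[[bx xa] _]|[bx xa]] //; do 2?split=> //; exact: boundary_cons.
  by move=> _; rewrite pconsK addrK.
- move=> a b ab; rewrite subst_op_comp; apply: subst_op_False => -[x n] /=.
  by move=> [_ [_ [ba]]]; apply: ab.
- move=> a; rewrite !subst_op_comp; apply: subst_op_eq => -[x n] /=.
    split=> [[[[bx xa] _] _]|[bx xa]] //.
    have bs := boundary_shift bx; have sa := boundary_rw bx xa.
    by have bc := boundary_cons bs sa; do 3?split=> //.
  by move=> [[[bx xa] _] _]; rewrite pshiftK // addrNK.
- move=> a; rewrite !subst_op_comp; apply: subst_op_eq => -[x n] /=.
    rewrite pconsK; split=> [[[[bx xa] _] _]|[bx xa]] //.
    by have bc := boundary_cons bx xa; do 3?split=> //.
  by move=> [[[bx xa] _] _]; rewrite addrK pconsK.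
move=> A l Areg /List_NoDupP ul lA; have BA : BB A.
  by case: Areg => [[]//|->]; exact: BB0 HN.
rewrite (eq_bigr _ (fun a _ => rep_sps' a BA)).
apply: (proj1 (@endoP R rep_space _ _)) => f; apply/funext => -[x n].
rewrite endo_sum fct_sumE /= /subst_fun /=.
have [[bx xA]|nbx] := pselect (boundary x /\ x.2 0%N A); last first.
  rewrite asboolF // big1 // => a _; rewrite asboolF // => -[bx _ xA].
  exact: nbx.
(* A path whose first filter contains a regular set cannot stop at once, so exactly one letter of
   [l] contributes to the sum. *)
have [a xa] : exists a, x.1 0%N = Some a.
  have := bx 0%N; case: (x.1 0%N) => [a _|[pF nreg]]; first by exists a.
  case: Areg => [/nreg//|A0]; case: pF => _ F0 _ _.
  by case: F0; rewrite -A0.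
have al : a \in l.
  apply/List_InP/lA; have [pF _] := bx 1%N; apply/set0P/eqP => A0.
  by move: xA; rewrite (boundary_head bx xa BA) A0; case: pF.
rewrite (bigD1_seq a) //= !asboolT // big1 ?addr0 // => b ba.
by rewrite asboolF // => -[_ + _]; rewrite xa => -[/esym/eqP]; apply/negP.
Qed.
End Representation.
(** * Leavitt labelled path algebras *)

Section Universal.
Variables (E0 E1 : Type) (Alph : eqType) (r s : E1 -> E0) (lab : E1 -> Alph).
Local Notation rg := (rg r s lab).
Local Notation rw := (rw r s lab).
Variable BB : set (set E0).
Hypothesis HN : normal_labelled_space r s lab BB.
Variables (R : comPzRingType) (L : nalg R) (p : set E0 -> L) (sg sg' : Alph -> L).
Hypothesis HL : is_LLPA r s lab BB p sg sg'.
Local Notation "x ** y" := (namul L x y) (at level 40, left associativity).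

(* By uniqueness, the universal map into the subalgebra [P] followed by the
   inclusion is the identity. *)
Lemma LLPA_generated (P : L -> Prop) :
  P 0 -> (forall x y, P x -> P y -> P (x + y)) ->
  (forall c x, P x -> P (c *: x)) -> (forall x y, P x -> P y -> P (x ** y)) ->
  (forall A, BB A -> P (p A)) -> (forall a, P (sg a)) -> (forall a, P (sg' a)) ->
  forall x, P x.
Proof.
move=> P0 PD PZ PM Pp Ps Ps'.
(* The default [0] outside [P] is harmless, as the relations involve only sets in [BB]. *)
pose S := subalg_nalg P0 PD PZ PM; pose q (x : L) : S := insubd (0 : S) x.
have qK x : P x -> subalg_val (q x) = x.
  by move=> Px; rewrite [LHS](insubdK (0 : S)) //; exact/asboolP.
have [[Hp1 [Hp2 [Hp3 [Hp4 [Hp5 [Hp6 [Hp7 [Hp8 [Hp9 Hp10]]]]]]]]] univ] := HL.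
have BBg := BB_rg HN; have BBI := BBI HN; have BBU := BBU HN.
have BBw a : BB (rw [:: a]) by exact: (BB_rw HN).
have BB0 := BB0 HN.
have fam : @LLPA_family _ _ _ r s lab BB _ S
    (fun A => q (p A)) (fun a => q (sg a)) (fun a => q (sg' a)).
  split; [|split; [|split; [|split; [|split; [|split; [|split; [|split; [|split]]]]]]]].
  - move=> A B BA BbB; apply: val_inj => /=; rewrite !qK; auto.
  - move=> A B BA BbB; apply: val_inj; rewrite /= !qK; auto.
  - by apply: val_inj; rewrite /= Hp3 qK.
  - move=> A a BA; apply: val_inj; rewrite /= !qK; auto.
  - move=> A a BA; apply: val_inj; rewrite /= !qK; auto.
  - move=> a; apply: val_inj; rewrite /= !qK; auto.
  - move=> a b ab; apply: val_inj; rewrite /= !qK; auto.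
  - move=> a; apply: val_inj; rewrite /= !qK; auto.
  - move=> a; apply: val_inj; rewrite /= !qK; auto.
  move=> A l Areg ul lA; have BA : BB A by case: Areg => [[]|->].
  apply: val_inj; apply: (etrans _ (esym (subalg_val_sum _ _))).
  rewrite /= qK; auto.
  rewrite (Hp10 A l) //; apply: eq_bigr => a _; rewrite /= !qK; auto.
have [[psi [[psiD psiZ psiM] psip psis psis']] _] := univ S _ _ _ fam.
have [_ uniq_psi] := univ L p sg sg' HL.1.
have E : (fun x => subalg_val (psi x)) = id.
  apply: uniq_psi => //.
  - by split=> *; rewrite ?psiD ?psiZ ?psiM.
  - by move=> A BA; rewrite psip // qK //; exact: Pp.
  - by move=> a; rewrite psis qK.
  - by move=> a; rewrite psis' qK.
move=> x; have := congr1 (fun f => f x) E => /= <-.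
by case: (psi x) => y Py; exact/asboolP.
Qed.

(** * Calculus with the generators *)

Local Notation "s_( w ) x" := (lmulw sg w x) (at level 35, format "s_( w )  x").

Lemma pI A B : BB A -> BB B -> p A ** p B = p (A `&` B).
Proof. by move=> BA BbB; case: HL => -[+ _] _ => ->. Qed.

Lemma p0 : p set0 = 0.
Proof. by case: HL => -[_ [_ []]]. Qed.

Lemma pU A B : BB A -> BB B -> p (A `|` B) = p A + p B - p (A `&` B).
Proof. by move=> BA BbB; case: HL => -[_ [+ _]] _ => ->. Qed.

Lemma p_s A a : BB A -> p A ** sg a = sg a ** p (rg A [:: a]).
Proof. by move=> BA; case: HL => -[_ [_ [_ [+ _]]]] _ => ->. Qed.

Lemma s'_p A a : BB A -> sg' a ** p A = p (rg A [:: a]) ** sg' a.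
Proof. by move=> BA; case: HL => -[_ [_ [_ [_ [+ _]]]]] _ => ->. Qed.

Lemma s'_s a : sg' a ** sg a = p (rw [:: a]).
Proof. by case: HL => -[_ [_ [_ [_ [_ [+ _]]]]]] _ => ->. Qed.

Lemma s'_s_neq a b : a != b -> sg' b ** sg a = 0.
Proof.
by move/eqP; case: HL => -[_ [_ [_ [_ [_ [_ [H _]]]]]]] _; exact: H.
Qed.

Lemma s_p_rw a : sg a ** p (rw [:: a]) = sg a.
Proof.
by case: HL => -[_ [_ [_ [_ [_ [_ [_ [+ _]]]]]]]] _ => {2}<-; rewrite -s'_s namulA.
Qed.

Lemma p_rw_s' a : p (rw [:: a]) ** sg' a = sg' a.
Proof.
by case: HL => -[_ [_ [_ [_ [_ [_ [_ [_ [+ _]]]]]]]]] _ => {2}<-; rewrite -s'_s.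
Qed.

Lemma p_regular A (F : seq Alph) : BB A -> uniq F ->
  (forall a, a \in F <-> LE1 r s lab A a) ->
  Breg r s lab BB A -> p A = \sum_(a <- F) sg a ** p (rg A [:: a]) ** sg' a.
Proof.
move=> BA uF FA Areg; case: HL => -[_ [_ [_ [_ [_ [_ [_ [_ [_ H]]]]]]]]] _.
apply: H => //; first exact/List_NoDupP.
by move=> a; rewrite -FA; exact: List_InP.
Qed.

Lemma p_subl A B : BB A -> BB B -> A `<=` B -> p A ** p B = p A.
Proof. by move=> BA BbB AB; rewrite pI // (setIidl AB). Qed.

Lemma p_subr A B : BB A -> BB B -> A `<=` B -> p B ** p A = p A.
Proof. by move=> BA BbB AB; rewrite pI // (setIidr AB). Qed.

Lemma p_split A B : BB A -> BB B -> p A = p (A `&` B) + p (A `\` B).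
Proof.
move=> BA BbB; have AE : (A `&` B) `|` (A `\` B) = A.
  apply/seteqP; split=> x; first by move=> [[]|[]].
  by move=> Ax; have [Bx|nBx] := pselect (B x); [left|right].
rewrite -{1}AE pU; [|exact: (BBI HN)|exact: (BBD HN)].
suff -> : (A `&` B) `&` (A `\` B) = set0 by rewrite p0 subr0.
by apply/seteqP; split=> // x [[_ ?] []].
Qed.

Lemma lmulw0 w : s_(w) 0 = 0.
Proof. by elim: w => [//|a w /= ->]; rewrite namul0r. Qed.

Lemma lmulw_mul w x y : s_(w) x ** y = s_(w) (x ** y).
Proof. by elim: w => [//|a w /= <-]; rewrite namulA. Qed.

Lemma lmulw_rcons w a x : s_(rcons w a) x = s_(w) (sg a ** x).
Proof. by rewrite /lmulw foldr_rcons. Qed.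

Lemma p_lmulw A w x : BB A -> p A ** s_(w) x = s_(w) (p (rg A w) ** x).
Proof.
elim: w A => [//|a w IH] A BA /=.
by rewrite namulA p_s // -namulA IH; [rewrite [in RHS]rg_cons|exact: (BB_rg HN)].
Qed.

Lemma s'_lmulw a b w x : sg' a ** s_(b :: w) x =
  if b == a then p (rw [:: a]) ** s_(w) x else 0.
Proof.
rewrite /= namulA; case: eqVneq => [->|ba]; first by rewrite s'_s.
by rewrite s'_s_neq // namul0l.
Qed.

(* Evaluate at a boundary path with [A] in its filter the image of the
   indicator function of degree [0]. *)
Lemma LLPA_nonvanishing c (W : seq (R * seq Alph)) A : BB A -> A !=set0 ->
  all (fun d => d.2 != [::]) W ->
  c *: p A + \sum_(d <- W) d.1 *: s_(d.2) (p A) = 0 -> c = 0.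
Proof.
move=> BA A0 Wne z0; have [x bx xA] := boundary_ex HN BA A0.
have [[psi [[psiD psiZ psiM] psip psis _]] _] := HL.2 _ _ _ _ (rep_family HN R).
pose f0 : rep_space E0 Alph R := fun z => (z.2 == 0)%:R.
(* Each letter raises the degree of the support by one, starting from degree [0] for [f0]. *)
have deg w y n : n != (size w)%:Z -> psi (s_(w) (p A)) f0 (y, n) = 0.
  elim: w y n => [|a w IH] y n nw /=.
    by rewrite psip //= /subst_fun; case: asboolP => //= _; rewrite /f0 (negPf nw).
  rewrite psiM psis /= /subst_fun; case: asboolP => //= _; apply: IH.
  by apply: contra nw => /eqP nw; rewrite -(subrK 1 n) nw /= -addn1 PoszD.
have psi0 : psi 0 = 0 by rewrite -(scale0r 0) psiZ scale0r.
have psi_sum : psi (\sum_(d <- W) d.1 *: s_(d.2) (p A)) f0 (x, 0) = 0.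
  elim: W Wne {z0} => [|d W IH] /=; first by rewrite big_nil psi0.
  move=> /andP[dne /IH W0]; rewrite big_cons psiD psiZ.
  change (d.1 * psi (s_(d.2) (p A)) f0 (x, 0) +
          psi (\sum_(j <- W) j.1 *: s_(j.2) (p A)) f0 (x, 0) = 0).
  by rewrite W0 addr0 deg ?mulr0 //; case: (d.2) dne.
have := congr1 (fun u => psi u f0 (x, 0)) z0; rewrite psi0 psiD psiZ.
change (c * psi (p A) f0 (x, 0) +
  psi (\sum_(d <- W) d.1 *: s_(d.2) (p A)) f0 (x, 0) = 0 -> c = 0).
rewrite psi_sum addr0 psip //= /subst_fun asboolT //= /f0 eqxx.
by rewrite mulr1.
Qed.

(* [kill w E]: the compression of [s_w] to [p_E] vanishes after compressing
   further along some path to a nonempty set.  Compressing by a letter [a]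
   rotates [w] when [w] starts with [a] and gives [0] otherwise. *)
Inductive kill : seq Alph -> set E0 -> Prop :=
| kill_restrict w E B : BB B -> B !=set0 -> B `<=` E -> rg B w `&` B = set0 ->
    kill w E
| kill_head a w E : rg E [:: a] !=set0 -> ohead w != Some a -> kill w E
| kill_sub w E B : BB B -> B `<=` E -> kill w B -> kill w E
| kill_move a w E : kill (rcons w a) (rg E [:: a]) -> kill (a :: w) E.

(** One rotation per letter of [u]; this brings an exit at any position to the head of the word. *)
Lemma kill_moves u v E : kill (v ++ u) (rg E u) -> kill (u ++ v) E.
Proof.
elim: u v E => [|a u IH] v E /=; first by rewrite cats0.
move=> kvu; apply: kill_move; rewrite -cats1 -catA; apply: IH.
by rewrite cats1 cat_rcons -rg_cons.
Qed.

(** Each failure yields a set to compress to: [B] minus [rg B w] if [B] is not inside [rg B w];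
    after a full turn along [w], [rg E w] minus [E] if that is nonempty; and the set witnessing an
    exit, once its position is rotated to the head. *)
Lemma not_kill_cycle w E : BB E -> E !=set0 -> w <> [::] -> ~ kill w E ->
  cycle_without_exits r s lab BB w E.
Proof.
move=> BE E0' w0 nk.
have sub_rg B : BB B -> B `<=` E -> B `<=` rg B w.
  move=> BbB BE' x Bx; apply: contrapT => nx; apply: nk.
  apply: (@kill_restrict _ _ (B `\` rg B w)).
  - by apply: (BBD HN) => //; exact: (BB_rg HN).
  - by exists x.
  - by move=> y [/BE'].
  - apply/seteqP; split=> // y [rBy [_]]; apply.
    by apply: rg_mono rBy => z [].
have rg_subE : rg E w `<=` E.
  move=> x wx; apply: contrapT => nx; apply: nk; rewrite -[w]cats0.
  apply: kill_moves => /=; apply: (@kill_restrict _ _ (rg E w `\` E)).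
  - by apply: (BBD HN) => //; exact: (BB_rg HN).
  - by exists x.
  - by move=> y [].
  - rewrite (rg_setD HN) //; last exact: (BB_rg HN).
    by apply/seteqP; split=> // y [[_ nEy] [Ey _]].
(* A point of [rg B w] outside [B] lies in [E] minus [B], hence in the range of that difference,
   which is disjoint from [rg B w]. *)
have rgE B : BB B -> B `<=` E -> rg B w = B.
  move=> BbB BE'; apply/seteqP; split; last exact: sub_rg.
  move=> x Bx; apply: contrapT => nx.
  have : rg (E `\` B) w x.
    apply: sub_rg; [exact: (BBD HN)|by move=> y []|split=> //].
    by apply: rg_subE; exact: rg_mono Bx.
  by rewrite (rg_setD HN) // => -[].
have Lw : Lstar r s lab w.
  apply: contrapT => nL; have [x Ex] := E0'.
  by have := sub_rg E BE (@subset_refl _ E) x Ex; rewrite rg_not_Lstar.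
split.
  split=> //; last by move=> B [BbB _] BE'; exact: rgE.
  by split=> // x /(sub_rg E BE (@subset_refl _ E)); exact: rg_sub_rw.
move=> [k [kw [B [BbB B0 Bk LB]]]]; apply: nk.
(* An exit at position [size w] is one at position [0], because [rg E w = E]. *)
have [j jw [Bj Lj]] : exists2 j, (j < size w)%N &
    B `<=` rg E (take j w) /\ LE1 r s lab B <> [set a | onth w j = Some a].
  have sw : (0 < size w)%N by case: (w) w0.
  exists (k %% size w)%N; first by rewrite ltn_mod.
  split=> //; have [kw'|kw'] := ltnP k (size w); first by rewrite modn_small.
  have kE : k = size w by apply/eqP; rewrite eqn_leq kw.
  by rewrite kE modnn take0; move: Bk; rewrite kE take_size rgE.
have [b [v vE]] : exists b v, drop j w = b :: v.
  case dE: (drop j w) => [|b v]; last by exists b, v.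
  by move: jw; rewrite ltnNge -subn_eq0 -size_drop dE.
have wj : onth w j = Some b.
  rewrite -[w](cat_take_drop j) vE onth_cat size_take jw ltnn subnn //.
rewrite -[w](cat_take_drop j); apply: kill_moves; apply: (kill_sub BbB Bj).
(* Either [B] emits a letter other than the head [b], or it does not emit [b] and its range along
   the rotated word is empty. *)
rewrite vE; have [[a [aB ab]]|nab] := pselect (exists a, LE1 r s lab B a /\ a != b).
  by apply: (@kill_head a) => //=; apply: contra ab => /eqP[->].
have LBb a : LE1 r s lab B a -> a = b.
  by move=> aB; apply/eqP/negPn/negP => ab; apply: nab; exists a.
apply: (@kill_restrict _ _ B) => //=; rewrite rg_cons.
suff -> : rg B [:: b] = set0 by rewrite rg_set0 set0I.
apply/seteqP; split=> // x Bx; apply: Lj; apply/seteqP; split=> a /=.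
  by move=> /LBb->.
by rewrite wj => -[<-]; exists x.
Qed.

(** * Ideals that meet the abelian core trivially *)

Section Ideal.
Variable I : L -> Prop.
Hypotheses (Il : forall x y, I y -> I (x ** y)) (Ir : forall x y, I x -> I (x ** y)).
Hypothesis Icore : forall x, I x -> abelian_core r s lab BB p sg sg' x -> x = 0.

(** The compression by [p E] of a formal combination of words with constant term [c]. Keeping [W] as
    a list makes its length available for induction. *)
Definition corner (c : R) (W : seq (R * seq Alph)) (E : set E0) : L :=
  c *: p E + \sum_(d <- W) d.1 *: (p E ** s_(d.2) (p E)).

Lemma corner_sub c W E B : BB E -> BB B -> B `<=` E ->
  p B ** corner c W E ** p B = corner c W B.
Proof.
move=> BE BbB sBE; rewrite /corner namulDr namulDl namulZr namulZl.
rewrite p_subl // pI // setIid namul_sumr namul_suml; congr (_ + _).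
apply: eq_bigr => d _; rewrite namulZr namulZl namulA p_subl //.
by rewrite -namulA lmulw_mul p_subr.
Qed.

(** On the left [sg' a] cancels a leading [a] and kills words with another head; on the right [sg a]
    appends the letter, which completes the rotation. *)
Lemma corner_move a c W E : BB E -> all (fun d => d.2 != [::]) W ->
  p (rg E [:: a]) ** (sg' a ** corner c W E ** sg a) ** p (rg E [:: a]) =
  corner c [seq (d.1, rot 1 d.2) | d <- W & ohead d.2 == Some a] (rg E [:: a]).
Proof.
move=> BE Wne; have BEa : BB (rg E [:: a]) by exact: (BB_rg HN).
have BW : BB (rw [:: a]) by exact: (BB_rw HN).
have s'ps : sg' a ** p E ** sg a = p (rg E [:: a]).
  by rewrite s'_p // -namulA s'_s p_subl //; exact: rg_sub_rw.
rewrite /corner !(namulDr, namulDl) !(namulZr, namulZl) s'ps !pI // !setIid.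
congr (_ + _); rewrite namul_sumr !namul_suml namul_sumr namul_suml big_map big_filter.
rewrite [RHS]big_mkcond !big_seq; apply: eq_bigr => d dW /=.
have := allP Wne _ dW; case: (d.2) => // b w _; rewrite /ohead.
rewrite !(namulZr, namulZl) (inj_eq Some_inj); set q := p (rg E [:: a]).
have -> : q ** (sg' a ** (p E ** s_(b :: w) (p E)) ** sg a) ** q =
    q ** (sg' a ** s_(b :: w) (sg a ** q)).
  rewrite [sg' a ** _]namulA s'_p // -[p _ ** sg' a ** _]namulA.
  rewrite -[p _ ** _ ** sg a]namulA [q ** (p _ ** _)]namulA pI // setIid.
  rewrite -!namulA lmulw_mul [p E ** _]namulA p_s // -[sg a ** _ ** _]namulA.
  by rewrite pI // setIid.
rewrite s'_lmulw; case: eqVneq => [->|_]; last by rewrite namul0r scaler0.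
rewrite rot1_cons lmulw_rcons namulA pI // setIidl //.
  exact: rg_sub_rw.
exact: BEa.
Qed.

(** Induction on [kill]: restriction and head mismatch drop [w] from the list, while shrinking [E]
    or rotating gives a corner with no more terms. The coefficient [c] is never touched. *)
Lemma kill_shorter w E : kill w E -> forall c W, BB E ->
  all (fun d => d.2 != [::]) W -> w \in map snd W -> I (corner c W E) ->
  exists W' E', [/\ (size W' < size W)%N, all (fun d => d.2 != [::]) W',
    BB E', E' !=set0 & I (corner c W' E')].
Proof.
have move_ne (a : Alph) (W : seq (R * seq Alph)) : all (fun d => d.2 != [::]) W ->
    all (fun d => d.2 != [::])
      [seq (d.1, rot 1 d.2) | d <- W & ohead d.2 == Some a].
  move=> /allP Wne; apply/allP => _ /mapP[d + ->] /=.
  by rewrite mem_filter => /andP[_ /Wne]; rewrite -!size_eq0 size_rot.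
elim=> {w E} [w E B BbB B0 BE Bw|a w E Ea wa|w E B BbB BE _ IH|a w E _ IH]
  c W BbE Wne wW IW.
- exists [seq d <- W | d.2 != w], B; split=> //.
  + by have /mapP[d dW ->] := wW; apply: (size_filter_lt dW); rewrite eqxx.
  + by apply/allP => d; rewrite mem_filter => /andP[_ /(allP Wne)].
  suff -> : corner c [seq d <- W | d.2 != w] B = p B ** corner c W E ** p B.
    by apply: Ir; exact: Il.
  rewrite corner_sub // /corner big_filter [in RHS](bigID (fun d => d.2 != w)) /=.
  rewrite [X in _ + (_ + X)]big1 ?addr0 // => d /negPn/eqP->.
  by rewrite p_lmulw // pI //; [rewrite Bw p0 lmulw0 scaler0|exact: (BB_rg HN)].
- exists [seq (d.1, rot 1 d.2) | d <- W & ohead d.2 == Some a], (rg E [:: a]).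
  split=> //; [|exact: move_ne|exact: (BB_rg HN)|].
    by have /mapP[d dW wE] := wW; rewrite size_map (size_filter_lt dW) // -wE.
  by rewrite -corner_move //; apply: Ir; apply: Il; apply: Ir; exact: Il.
- apply: (IH c W) => //; rewrite -(corner_sub _ _ BbE) //.
  by apply: Ir; exact: Il.
have [||||W' [E' [sW W'ne BE' E'0 IW']]] := IH c
  [seq (d.1, rot 1 d.2) | d <- W & ohead d.2 == Some a].
- exact: (BB_rg HN).
- exact: move_ne.
- have /mapP[d dW wE] := wW; rewrite -rot1_cons wE; apply/mapP.
  exists (d.1, rot 1 d.2) => //; apply: map_f.
  by rewrite mem_filter dW -wE /= eqxx.
- by rewrite -corner_move //; apply: Ir; apply: Il; apply: Ir; exact: Il.
exists W', E'; split=> //; apply: leq_trans sW _.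
by rewrite size_map size_filter count_size.
Qed.

(** Induction on the number of terms: shorten while some word can be killed. Otherwise every word is
    a cycle without exits on [E], the corner lies in the core, hence is zero, and
    [LLPA_nonvanishing] applies. *)
Lemma corner_notin_ideal c W E : BB E -> E !=set0 ->
  all (fun d => d.2 != [::]) W -> I (corner c W E) -> c = 0.
Proof.
have [n] := ubnP (size W); elim: n => // n IH in W E * => sW BE E0' Wne IW.
have [[w [wW kw]]|nk] := pselect (exists w, w \in map snd W /\ kill w E).
  have [W' [E' [sW' W'ne BE' E'0 IW']]] := kill_shorter kw BE Wne wW IW.
  by apply: (IH W' E') => //; exact: leq_trans sW' _.
have cyc d : d \in W -> cycle_without_exits r s lab BB d.2 E.
  move=> dW; apply: not_kill_cycle => //; first exact/eqP/(allP Wne).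
  by move=> kd; apply: nk; exists d.2; split=> //; exact: map_f.
(* For a cycle [rg E w = E], so the left [p E] is absorbed and each term is a multiple of a core
   generator with empty [al]. *)
have cornerE : corner c W E = c *: p E + \sum_(d <- W) d.1 *: s_(d.2) (p E).
  congr (_ + _); rewrite !big_seq; apply: eq_bigr => d dW.
  have [[_ _ EB rgE] _] := cyc d dW.
  by rewrite p_lmulw // rgE // pI // setIid.
apply: (LLPA_nonvanishing BE E0' Wne); rewrite -cornerE; apply: Icore => //.
exists ((c, p E) :: [seq (d.1, s_(d.2) (p E)) | d <- W]); split; last first.
  by rewrite cornerE big_cons big_map.
have L0 : Lstar r s lab [::] by left.
move=> x /= [<-|/List_InP/mapP[d dW ->]].
  by exists [::]; split=> //; left; exists E.
by exists [::]; split=> //; right; exists d.2, E; split; [exact: cyc|right].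
Qed.

(** Multiplying on the left by [sg' a] for the successive letters [a] of a chosen word [v] of [W]
    strips them off, until the empty word occurs; its nonzero coefficient contradicts
    [corner_notin_ideal]. *)
Lemma real_notin_ideal (W : seq (seq Alph)) (cf : seq Alph -> R) E :
  W != [::] -> uniq W -> (forall w, w \in W -> cf w != 0 /\ E `<=` rw w) ->
  BB E -> E !=set0 -> ~ I (\sum_(w <- W) cf w *: s_(w) (p E)).
Proof.
case: W => // v W _; have: v \in v :: W by rewrite inE eqxx.
move: (v :: W) => {}W vW uW cfW BE E0' IW.
(* Left compression by [p E] gives a corner whose constant coefficient is that of the empty word. *)
have nil_in V h : [::] \in V -> uniq V -> (forall w, w \in V -> h w != 0) ->
    ~ I (\sum_(w <- V) h w *: s_(w) (p E)).
  move=> V0 uV hV IV; have /eqP := hV _ V0; apply.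
  apply: (@corner_notin_ideal _ [seq (h w, w) | w <- V & w != [::]] E) => //.
    by apply/allP => _ /mapP[w + ->]; rewrite mem_filter => /andP[].
  suff -> : corner (h [::]) [seq (h w, w) | w <- V & w != [::]] E =
    p E ** (\sum_(w <- V) h w *: s_(w) (p E)) by exact: Il.
  rewrite (bigD1_seq [::]) //= namulDr namulZr pI // setIid namul_sumr.
  rewrite /corner big_map big_filter; congr (_ + _).
  by apply: eq_bigr => w _; rewrite namulZr.
elim: v W cf vW uW cfW IW => [|a v IH] W cf vW uW cfW IW.
  by apply: (nil_in W cf) => // w /cfW[].
have [W0|W0] := boolP ([::] \in W); first by apply: (nil_in W cf) => // w /cfW[].
pose V := [seq behead w | w <- W & ohead w == Some a].
have mV w : w \in V -> a :: w \in W.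
  move=> /mapP[[|b u]]; rewrite mem_filter //= => /andP[/eqP[->]] + ->.
  by [].
apply: (IH V (fun w => cf (a :: w))).
- by apply/mapP; exists (a :: v) => //; rewrite mem_filter /= eqxx.
- rewrite map_inj_in_uniq ?filter_uniq // => -[|b u] [|c w]; rewrite !mem_filter //=.
  by move=> /andP[/eqP[->] _] /andP[/eqP[->] _] ->.
- move=> w /mV /cfW[cw Ew]; split=> //; apply: (subset_trans Ew).
  exact: (@rw_catr _ _ _ _ _ _ [:: a]).
suff -> : \sum_(w <- V) cf (a :: w) *: s_(w) (p E) =
    sg' a ** (\sum_(w <- W) cf w *: s_(w) (p E)) by exact: Il.
rewrite namul_sumr big_map big_filter [LHS]big_mkcond !big_seq.
apply: eq_bigr => -[|b w] wW; first by rewrite wW in W0.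
rewrite namulZr s'_lmulw /= (inj_eq Some_inj); case: eqVneq => [ba|_]; last first.
  by rewrite scaler0.
have BW : BB (rw [:: a]) by exact: (BB_rw HN).
(* The projection left by cancelling [a] is absorbed, since [E] lies in the range of [a :: w]. *)
rewrite p_lmulw // rg_rw p_subr ?ba //; first exact: (BB_rw HN).
by have [_] := cfW _ wW; rewrite ba.
Qed.

End Ideal.

(** * Elements without starred letters, and the filtration by starred length *)

Inductive real : L -> Prop :=
| real0 : real 0
| real_add c w A x : BB A -> A `<=` rw w -> real x -> real (c *: s_(w) (p A) + x).

Lemma real_term c w A : BB A -> A `<=` rw w -> real (c *: s_(w) (p A)).
Proof. by move=> BA Aw; rewrite -[_ *: _]addr0; apply: real_add => //; exact: real0. Qed.

Lemma realD x y : real x -> real y -> real (x + y).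
Proof.
move=> rx ry; elim: rx => [|c w A z BA Aw _ IH]; first by rewrite add0r.
by rewrite -addrA; exact: real_add.
Qed.

Lemma realZ c x : real x -> real (c *: x).
Proof.
elim=> [|d w A z BA Aw _ IH]; first by rewrite scaler0; exact: real0.
by rewrite scalerDr scalerA; exact: real_add.
Qed.

Lemma real_p x B : BB B -> real x -> real (x ** p B).
Proof.
move=> BbB; elim=> [|c w A z BA Aw _ IH]; first by rewrite namul0l; exact: real0.
rewrite namulDl namulZl lmulw_mul pI //; apply: real_add => //.
  exact: (BBI HN).
by move=> v [/Aw].
Qed.

Lemma real_s x a : real x -> real (x ** sg a).
Proof.
elim=> [|c w A z BA Aw _ IH]; first by rewrite namul0l; exact: real0.
rewrite namulDl namulZl lmulw_mul p_s // -lmulw_rcons; apply: real_add => //.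
  exact: (BB_rg HN).
by rewrite /Defs.rw rg_rcons; exact: rg_mono.
Qed.

(** The union of the sets occurring in [x] acts as a unit on the right. *)
Lemma real_unit x : real x -> exists2 E, BB E & x ** p E = x.
Proof.
elim=> [|c w A z BA Aw _ [E BE zE]].
  by exists set0; [exact: (BB0 HN)|rewrite namul0l].
have BAE : BB (A `|` E) by exact: (BBU HN).
exists (A `|` E) => //; rewrite namulDl namulZl lmulw_mul p_subl //.
by rewrite -zE -namulA p_subl.
Qed.

(** For each term with set [A], [y] stays nonzero either on the part of [E] inside [A], where the
    term keeps its word, or on the part outside, where it vanishes. A separate [y] is carried since
    the ideal element to keep nonzero may differ from its real part [x]. *)
Lemma real_refine y x E : real x -> BB E -> y ** p E != 0 ->
  exists E', [/\ BB E', E' `<=` E, y ** p E' != 0 &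
    exists W cf, [/\ uniq W, forall w, w \in W -> E' `<=` rw w &
      x ** p E' = \sum_(w <- W) cf w *: s_(w) (p E')]].
Proof.
move=> rx; elim: rx E => [|c w A z BA Aw _ IH] E BE yE.
  exists E; split=> //; exists [::], (fun=> 0); split=> //.
  by rewrite big_nil namul0l.
have BEA : BB (E `&` A) by exact: (BBI HN).
have BED : BB (E `\` A) by exact: (BBD HN).
have [yEA|yEA] := eqVneq (y ** p (E `&` A)) 0.
  have yED : y ** p (E `\` A) != 0.
    by apply: contra yE => /eqP yED; rewrite (p_split BE BA) namulDr yEA yED addr0.
  have [E' [BE' sE' yE' [W [cf [uW EW zE']]]]] := IH _ BED yED.
  exists E'; split=> //; first by move=> v /sE'[].
  exists W, cf; split=> //; rewrite namulDl namulZl lmulw_mul pI //.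
  suff -> : A `&` E' = set0 by rewrite p0 lmulw0 scaler0 add0r.
  by apply/seteqP; split=> // v [Av /sE'[]].
have [E' [BE' sE' yE' [W [cf [uW EW zE']]]]] := IH _ BEA yEA.
have sE'A : E' `<=` A by move=> v /sE'[].
exists E'; split=> //; first by move=> v /sE'[].
(* The coefficient [c] is merged when [w] already occurs, so that the words stay distinct. *)
pose h v := if v == w then if w \in W then cf w + c else c else cf v.
have hE v : v != w -> h v *: s_(v) (p E') = cf v *: s_(v) (p E').
  by rewrite /h => /negPf->.
exists (if w \in W then W else w :: W), h.
rewrite namulDl namulZl lmulw_mul p_subr // zE'.
have [wW|wW] := boolP (w \in W); split=> //.
- rewrite !(bigD1_seq w wW uW) /= /h eqxx wW scalerDl addrA [c *: _ + _]addrC.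
  by congr (_ + _); apply: eq_bigr => v vw; rewrite (negPf vw).
- by rewrite /= wW.
- move=> v; rewrite inE => /orP[/eqP->|/EW //].
  by apply: subset_trans Aw.
- rewrite big_cons /h eqxx (negPf wW); congr (_ + _); rewrite !big_seq.
  by apply: eq_bigr => v vW; case: eqVneq => // vw; move: wW; rewrite -vw vW.
Qed.

Lemma real_atom y x E : real x -> BB E -> y ** p E != 0 ->
  exists E', [/\ BB E', E' !=set0, E' `<=` E, y ** p E' != 0 &
    exists W cf, [/\ uniq W, forall w, w \in W -> cf w != 0 /\ E' `<=` rw w &
      x ** p E' = \sum_(w <- W) cf w *: s_(w) (p E')]].
Proof.
move=> rx BE yE; have [E' [BE' sE' yE' [W [cf [uW EW xE']]]]] := real_refine rx BE yE.
exists E'; split=> //.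
  by apply/set0P; apply: contra yE' => /eqP->; rewrite p0 namul0r.
exists [seq w <- W | cf w != 0], cf; split; first exact: filter_uniq.
  by move=> w; rewrite mem_filter => /andP[cw /EW].
rewrite xE' big_filter [RHS]big_mkcond; apply: eq_bigr => w _.
by case: eqVneq => //= ->; rewrite scale0r.
Qed.

(* [lev n] is spanned by the [s_alpha p_A s_beta^*] with [|beta| <= n]. *)
Inductive lev : nat -> L -> Prop :=
| lev_real n x : real x -> lev n x
| lev_add n b x y : lev n x -> lev n.+1 y -> lev n.+1 (x ** sg' b + y).

Lemma levD n x y : lev n x -> lev n y -> lev n (x + y).
Proof.
elim=> {n x} [n x rx|n b x z lx _ lz IH ly]; last first.
  by rewrite -addrA; apply: lev_add => //; exact: IH.
elim=> {n y} [n y ry|n b y z ly _ lz IH]; first by apply: lev_real; exact: realD.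
by rewrite addrCA; exact: lev_add.
Qed.

Lemma levZ n c x : lev n x -> lev n (c *: x).
Proof.
elim=> {n x} [n x rx|n b x z _ IHx _ IHz]; first by apply: lev_real; exact: realZ.
by rewrite scalerDr -namulZl; exact: lev_add.
Qed.

Lemma lev_p n x B : BB B -> lev n x -> lev n (x ** p B).
Proof.
move=> + lx; elim: lx B => {n x} [n x rx|n b x z _ IHx _ IHz] B BbB.
  by apply: lev_real; exact: real_p.
rewrite namulDl -namulA s'_p // namulA; apply: lev_add; last exact: IHz.
by apply: IHx; exact: (BB_rg HN).
Qed.

Lemma levS n x : lev n x -> lev n.+1 x.
Proof.
by elim=> {n x} [n x rx|n b x z _ IHx _ IHz]; [exact: lev_real|exact: lev_add].
Qed.

Lemma lev_leq m n x : (m <= n)%N -> lev m x -> lev n x.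
Proof. by move=> /subnK <- lx; elim: (n - m)%N => // k; exact: levS. Qed.

Lemma lev_s n x a : lev n x -> lev n (x ** sg a).
Proof.
elim=> {n x} [n x rx|n b x z lx _ _ IHz].
  by apply: lev_real; exact: real_s.
rewrite namulDl -namulA; apply: levD => //; case: (eqVneq a b) => [->|ab].
  by rewrite s'_s; apply/levS/lev_p => //; exact: (BB_rw HN).
by rewrite s'_s_neq // namul0r; apply: lev_real; exact: real0.
Qed.

Lemma lev_s' n x a : lev n x -> lev n.+1 (x ** sg' a).
Proof.
by move=> lx; rewrite -[_ ** _]addr0; apply: lev_add => //; exact: lev_real real0.
Qed.

(** Having a level is not evidently closed under products, so generation is applied to a stronger
    property: right multiplication by [x] also preserves having a level. *)
Lemma lev_all x : exists n, lev n x.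
Proof.
suff [] : (exists n, lev n x) /\ (forall n y, lev n y -> exists m, lev m (y ** x)) by [].
move: x; apply: LLPA_generated.
- split=> [|n y _]; first by exists 0%N; exact: lev_real real0.
  by exists 0%N; rewrite namul0r; exact: lev_real real0.
- move=> x y [[n lx] IHx] [[m ly] IHy]; split.
    exists (maxn n m); apply: levD; [apply: lev_leq lx|apply: lev_leq ly].
      exact: leq_maxl.
    exact: leq_maxr.
  move=> k z lz; have [[i zx] [j zy]] := (IHx _ _ lz, IHy _ _ lz).
  rewrite namulDr; exists (maxn i j).
  apply: levD; [apply: lev_leq zx|apply: lev_leq zy].
    exact: leq_maxl.
  exact: leq_maxr.
- move=> c x [[n lx] IHx]; split; first by exists n; exact: levZ.
  by move=> k z /IHx[m zx]; exists m; rewrite namulZr; exact: levZ.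
- move=> x y [[n lx] IHx] [_ IHy]; split; first exact: IHy lx.
  by move=> k z /IHx[m /IHy]; rewrite namulA.
- move=> A BA; split=> [|n y ly]; last by exists n; exact: lev_p.
  exists 0%N; apply: lev_real; rewrite -[p A]scale1r.
  exact: (@real_term 1 [::]).
- move=> a; split=> [|n y ly]; last by exists n; exact: lev_s.
  exists 0%N; apply: lev_real; rewrite -[sg a]scale1r -s_p_rw.
  by apply: (@real_term 1 [:: a]) => //; exact: (BB_rw HN).
move=> a; split=> [|n y ly]; last by exists n.+1; exact: lev_s'.
exists 1%N; rewrite -p_rw_s'; apply: lev_s'; apply: lev_real.
rewrite -[p _]scale1r; apply: (@real_term 1 [::]) => //; exact: (BB_rw HN).
Qed.

(** [t] gathers the terms ending in a starred letter, and [F] lists those letters. As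
    [sg' b ** sg a] is zero or, for [a = b], a projection fixing [sg' b], each [t ** sg a] loses a
    level and the sum recovers [t]. *)
Lemma lev_decomp n x : lev n.+1 x -> exists x0 t (F : seq Alph),
  [/\ real x0, x = x0 + t, forall a, lev n (t ** sg a),
      forall a, a \notin F -> t ** sg a = 0 &
      forall G, uniq G -> {subset F <= G} ->
        \sum_(a <- G) t ** sg a ** sg' a = t].
Proof.
move En : n.+1 => m lx; elim: lx n En => {m x} [m x rx n _|m b x y lx _ _ IH n [En]].
  exists x, 0, [::]; split=> //; rewrite ?addr0 // => a *; rewrite ?namul0l //.
    by apply: lev_real; exact: real0.
  by rewrite big1 // => i _; rewrite !namul0l.
subst n; have [y0 [t [F [ry0 yE lt tF tG]]]] := IH _ erefl.
exists y0, (x ** sg' b + t), (b :: F); split=> //.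
- by rewrite yE addrCA.
- move=> a; rewrite namulDl; apply: levD => //; rewrite -namulA.
  case: (eqVneq a b) => [->|ab]; first by rewrite s'_s; apply: lev_p => //; exact: (BB_rw HN).
  by rewrite s'_s_neq // namul0r; apply: lev_real; exact: real0.
- move=> a; rewrite inE negb_or => /andP[ab aF].
  by rewrite namulDl tF // -namulA s'_s_neq // namul0r addr0.
move=> G uG bFG; have bG : b \in G by apply: bFG; rewrite inE eqxx.
rewrite -[in RHS](tG G uG) => [|a aF]; last by apply: bFG; rewrite inE aF orbT.
under eq_bigr do rewrite !namulDl; rewrite big_split /=; congr (_ + _).
rewrite (bigD1_seq b) //= big1 ?addr0 => [|a ab].
  by rewrite -(namulA x) s'_s -namulA p_rw_s'.
by rewrite -(namulA x) s'_s_neq // namul0r namul0l.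
Qed.

(** * Vanishing of ideals that meet the core trivially *)

Section IdealMain.
Variable I : L -> Prop.
Hypotheses (Il : forall x y, I y -> I (x ** y)) (Ir : forall x y, I x -> I (x ** y)).
Hypothesis Icore : forall x, I x -> abelian_core r s lab BB p sg sg' x -> x = 0.

(** Induction on the level; real elements fall to [real_notin_ideal]. Otherwise each [x ** sg a]
    vanishes by induction, so [x = x0 - Q x0] with [x0] real. On a suitable [E'] all emitted letters
    lie in [F]; then either a nonempty subset emits nothing and compression leaves a real element,
    or [E'] is regular and relation (v) gives [x ** p E' = 0]. *)
Lemma lev_ideal n x : lev n x -> I x -> x = 0.
Proof.
elim: n x => [|n IH] x lx Ix; apply/eqP/negPn/negP => xn0.
  have rx : real x by move: lx; move En : 0%N => m lx; case: lx En.
  have [E BE xE] := real_unit rx; rewrite -xE in xn0.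
  have [E' [BE' E'0 _ xE' [W [cf [uW cW xW]]]]] := real_atom rx BE xn0.
  apply: (real_notin_ideal Il Ir Icore _ uW cW BE' E'0); last by rewrite -xW; exact: Ir.
  by apply: contra xE' => /eqP W0; rewrite xW W0 big_nil.
have [x0 [t [F [rx0 xE lt tF tG]]]] := lev_decomp lx.
have xs a : x ** sg a = 0.
  apply: IH; last exact: Ir.
  by rewrite xE namulDl; apply: levD => //; apply: lev_real; exact: real_s.
pose G := undup F; pose Q y := \sum_(a <- G) y ** sg a ** sg' a.
have GF a : (a \in G) = (a \in F) by rewrite mem_undup.
have x0s a : a \notin F -> x0 ** sg a = 0.
  by move=> aF; have := xs a; rewrite xE namulDl tF // addr0.
(* From [x ** sg a = 0], [t ** sg a] is the opposite of [x0 ** sg a]; [t] is rebuilt from these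
   products. *)
have xQ : x = x0 - Q x0.
  rewrite {1}xE; congr (_ + _).
  rewrite -[LHS](tG G (undup_uniq F)) => [|a]; last by rewrite GF.
  rewrite /Q -sumrN; apply: eq_bigr => a _; rewrite -namulNl; congr (_ ** _).
  by apply/eqP; rewrite -addr_eq0 addrC -namulDl -xE xs.
have Qp y A : BB A -> Q y ** p A = Q (y ** p A).
  move=> BA; rewrite /Q namul_suml; apply: eq_bigr => a _.
  by rewrite -!namulA s'_p // [p A ** _]namulA p_s // -!namulA.
have xp A : BB A -> x ** p A = x0 ** p A - Q (x0 ** p A).
  by move=> BA; rewrite xQ namulDl namulNl Qp.
have [E BE x0E] := real_unit rx0.
have xEn0 : x ** p E != 0 by rewrite xp // x0E -xQ.
have [E' [BE' E'0 _ xE' [W [cf [uW cW x0W]]]]] := real_atom rx0 BE xEn0.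
have Q0 : Q 0 = 0 by rewrite /Q big1 // => a _; rewrite !namul0l.
have Wn0 : W != [::].
  apply: contra xE' => /eqP W0; rewrite xp // x0W W0 big_nil Q0 subr0 //.
have I0 : I 0 by rewrite -(namul0l x); exact: Il.
(* A letter [a] outside [F] kills [x0], yet [x0 ** p E' ** sg a] is a combination of distinct words
   [rcons w a] with nonzero coefficients, so it cannot be zero. *)
have E'F a : LE1 r s lab E' a -> a \in G.
  move=> E'a; rewrite GF; apply/negPn/negP => aF.
  pose h (w : seq Alph) := cf (take (size w).-1 w).
  have hE w : h (rcons w a) = cf w.
    by rewrite /h size_rcons -cats1 take_size_cat.
  apply: (@real_notin_ideal I Il Ir Icore [seq rcons w a | w <- W] h (rg E' [:: a])).
  - by case: (W) Wn0.
  - by rewrite map_inj_uniq //; exact: rcons_injl.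
  - move=> _ /mapP[w /cW[cw E'w] ->]; rewrite hE; split=> //.
    by rewrite /Defs.rw rg_rcons; exact: rg_mono.
  - exact: (BB_rg HN).
  - exact: E'a.
  suff -> : \sum_(w <- [seq rcons w a | w <- W]) h w *: s_(w) (p (rg E' [:: a])) = 0
    by [].
  transitivity (x0 ** p E' ** sg a); last first.
    by rewrite -namulA p_s // namulA x0s // namul0l.
  rewrite x0W namul_suml big_map; apply: eq_bigr => w _.
  by rewrite hE lmulw_rcons namulZl lmulw_mul p_s.
have [[B [BbB B0 BE'B LB]]|nB] := pselect (exists B,
    [/\ BB B, B !=set0, B `<=` E' & forall a, rg B [:: a] = set0]).
  apply: (real_notin_ideal Il Ir Icore Wn0 uW _ BbB B0 (cf := cf)).
    by move=> w /cW[cw E'w]; split=> //; exact: subset_trans E'w.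
  suff -> : \sum_(w <- W) cf w *: s_(w) (p B) = x ** p B by exact: Ir.
  rewrite xp // [Q _]big1 ?subr0 => [|a _].
    rewrite -(p_subr BbB BE' BE'B) namulA x0W namul_suml.
    by apply: eq_bigr => w _; rewrite namulZl lmulw_mul p_subr.
  by rewrite -(namulA x0) p_s // LB p0 namul0r namul0r namul0l.
have E'reg : Breg r s lab BB E'.
  left; split=> // B BbB B0 BE'B; split; last first.
    by exists G => a aB; apply/List_InP/E'F; exact: LE1_mono aB.
  apply: contrapT => LB; apply: nB; exists B; split=> // a.
  apply/seteqP; split=> // v Bav; apply: LB; exists a; exists v; exact: Bav.
pose K := [seq a <- G | `[< LE1 r s lab E' a >]].
have KE a : a \in K <-> LE1 r s lab E' a.
  rewrite mem_filter; split=> [/andP[/asboolP]//|E'a].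
  by apply/andP; split; [exact/asboolP|exact: E'F].
have pE' := p_regular BE' (filter_uniq _ (undup_uniq F)) KE E'reg.
(* Relation (v) sums over [K]; the other letters of [G] contribute zero to [Q]. *)
have Q0E' : Q (x0 ** p E') = x0 ** p E'.
  rewrite [in RHS]pE' namul_sumr /Q big_filter [RHS]big_mkcond; apply: eq_bigr => a _.
  case: asboolP => [_|nE'a]; first by rewrite -!namulA [p _ ** (_ ** _)]namulA p_s // -!namulA.
  have E'a : rg E' [:: a] = set0.
    by apply/seteqP; split=> // v E'av; apply: nE'a; exists v.
  by rewrite -(namulA x0) p_s // E'a p0 !namul0r namul0l.
by move: xE'; rewrite xp // Q0E' subrr eqxx.
Qed.

End IdealMain.

End Universal.

(** * From injectivity on the abelian core to injectivity of [phi] *)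

Theorem theorem8p14 (R : comPzRingType) (E0 E1 Alph : Type)
    (r s : E1 -> E0) (lab : E1 -> Alph) (BB : set (set E0))
    (L : nalg R) (p : set E0 -> L) (sg sg' : Alph -> L)
    (B : nalg R) (phi : L -> B) :
  normal_labelled_space r s lab BB ->
  is_LLPA r s lab BB p sg sg' ->
  nalg_hom phi ->
  (injective phi <->
   {in abelian_core r s lab BB p sg sg' &, injective phi}).
Proof.
move=> HN HL [phiD phiZ phiM]; split=> [phi_inj x y _ _|core_inj x y xy].
  exact: phi_inj.
have phi0 : phi 0 = 0 by rewrite -(scale0r 0) phiZ scale0r.
have core0 : abelian_core r s lab BB p sg sg' 0.
  by exists [::]; split=> //; rewrite big_nil.
apply/eqP; rewrite -subr_eq0; apply/eqP.
(* [{classic Alph}] equips the bare alphabet with classically decided equality. *)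
have [n ln] := @lev_all _ _ {classic Alph} _ _ _ _ HN _ _ _ _ _ HL (x - y).
(* The ideal is the kernel of [phi], which contains [x - y]. *)
apply: (@lev_ideal _ _ {classic Alph} _ _ _ _ HN _ _ _ _ _ HL
  (fun z => phi z = 0) _ _ _ _ _ ln).
- by move=> u v v0; rewrite phiM v0 namul0r.
- by move=> u v u0; rewrite phiM u0 namul0l.
- by move=> z z0 zcore; apply: core_inj; rewrite ?inE // z0 phi0.
- by rewrite -scaleN1r phiD phiZ xy scaleN1r subrr.
Qed.
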